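(* Let $X$ be a set, let $\Omega$ be a $\sigma$-algebra of subsets of $X$, let $E$ be a $\sigma$-Dedekind complete partially ordered vector space, and let $\mu:\Omega\to\overline{E^+}$ be an $\overline{E^+}$-valued measure. If $(f_n)_{n=1}^\infty$ is a sequence of measurable functions $f_n:X\to[0,\infty]$, then $$\int_X^{\mathrm o}\liminf_{n\to\infty}f_n\,\mathrm d\mu\ \le\ \bigvee_{n=1}^\infty\bigwedge_{k=n}^\infty\int_X^{\mathrm o}f_k\,\mathrm d\mu$$ in $\overline E$.
   Context: All vector spaces are real. A partially ordered vector space $E$ has a proper positive cone $E^+$ (i.e. $E^+\cap(-E^+)=\{0\}$), not required to be generating. $E$ is $\sigma$-Dedekind complete if every non-empty at most countably infinite subset of $E$ that is bounded from above has a supremum in $E$. Extended space: $\overline{E}=E\cup\{\infty\}$ (disjoint union), ordered by extending the order of $E$ with $x\le\infty$ for all $x\in\overline E$; $\infty+x=x+\infty=\infty$ for all $x\in\overline E$; $r\cdot\infty=\infty$ for real $r>0$ and $0\cdot\infty=0$. $\overline{E^+}=E^+\cup\{\infty\}$. Elements of $E$ are called finite. If $E$ is $\sigma$-Dedekind complete, then every non-empty at most countable subset of $\overline E$ has a supremum in $\overline E$, and every non-empty at most countable subset that is bounded from below in $\overline E$ by a finite element (or is $\{\infty\}$) has an infimum in $\overline E$. Suprema and infima in the claim are taken in $\overline E$; the limit inferior is taken pointwise in $[0,\infty]$. Measure: an $\overline{E^+}$-valued measure on $\Omega$ is a map $\mu:\Omega\to\overline{E^+}$ with $\mu(\emptyset)=0$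 and $\mu\big(\bigcup_{n=1}^\infty\Delta_n\big)=\bigvee_{N=1}^\infty\sum_{n=1}^N\mu(\Delta_n)$ in $\overline E$ for every pairwise disjoint sequence $(\Delta_n)$ in $\Omega$ with union in $\Omega$. Order integral: for $\varphi=\sum_{i=1}^n r_i\chi_{\Delta_i}$ with $r_i\in[0,\infty)$ and pairwise disjoint $\Delta_i\in\Omega$ (an elementary function), $\int_X^{\mathrm o}\varphi\,\mathrm d\mu:=\sum_{i=1}^n r_i\mu(\Delta_i)\in\overline{E^+}$ (independent of the representation). For measurable $f:X\to[0,\infty]$, choose any sequence of elementary functions $\varphi_n\uparrow f$ pointwise and put $\int_X^{\mathrm o}f\,\mathrm d\mu:=\bigvee_{n=1}^\infty\int_X^{\mathrm o}\varphi_n\,\mathrm d\mu$ in $\overline E$ (independent of the choice of the sequence). Measurable means $\Omega$–Borel measurable. *)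

(* Defs.v *)
From HB Require Import structures.
From mathcomp Require Import all_boot all_order all_algebra.
From mathcomp Require Import all_classical all_reals all_analysis measurable_realfun.
Import Order.TTheory GRing.Theory Num.Theory.
Import numFieldNormedType.Exports.

Set Implicit Arguments.
Unset Strict Implicit.
Unset Printing Implicit Defensive.

Local Open Scope classical_set_scope.
Local Open Scope ring_scope.

(** Partially ordered vector spaces; the positive cone is [[set x | 0 <= x]].
    Antisymmetry of the order says that it is proper; it need not generate. *)

HB.mixin Record isPOrderedVectSpace (R : numDomainType) E
    & Num.POrderedZmodule E & GRing.Lmodule R E := {
  pov_leD2r : forall x y z : E, x <= y -> x + z <= y + z ;
  pov_scale_ge0 : forall (r : R) (x : E), 0 <= r -> 0 <= x -> 0 <= r *: x
}.

#[short(type="povectType")]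
HB.structure Definition POrderedVectSpace (R : numDomainType) :=
  { E of Num.POrderedZmodule E & GRing.Lmodule R E & isPOrderedVectSpace R E }.

Definition sigma_dedekind_complete (R : numDomainType) (E : povectType R) :=
  forall A : set E,
    A !=set0 -> countable A -> has_ubound A -> supremums A !=set0.

(** The extended space: [E] with an added greatest element. *)

Inductive xvect (E : Type) : Type := XFin of E | XInf.
Arguments XInf {E}.

Section xvect_choice.
Variable E : choiceType.

Definition option_of_xvect (x : xvect E) : option E :=
  if x is XFin v then Some v else None.

Definition xvect_of_option (o : option E) : xvect E :=
  if o is Some v then XFin v else XInf.

Lemma option_of_xvectK : cancel option_of_xvect xvect_of_option.
Proof. by case. Qed.

HB.instance Definition _ := Choice.copy (xvect E) (can_type option_of_xvectK).

End xvect_choice.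

Section xvect_theory.
Variables (R : numDomainType) (E : povectType R).

Definition xle (x y : xvect E) : bool :=
  match x, y with
  | _, XInf => true
  | XInf, XFin _ => false
  | XFin v, XFin w => v <= w
  end.

Lemma xle_refl : reflexive xle.
Proof. by case=> //= v. Qed.

Lemma xle_anti : antisymmetric xle.
Proof. by move=> [v|] [w|] //= /le_anti ->. Qed.

Lemma xle_trans : transitive xle.
Proof. by move=> [w|] [v|] [u|] //=; exact: le_trans. Qed.

HB.instance Definition _ :=
  Order.Le_isPOrder.Build ring_display (xvect E) xle_refl xle_anti xle_trans.

Definition xadd (x y : xvect E) : xvect E :=
  match x, y with
  | XFin v, XFin w => XFin (v + w)
  | _, _ => XInf
  end.

Lemma xaddA : associative xadd.
Proof. by move=> [u|] [v|] [w|] //=; rewrite addrA. Qed.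

Lemma xaddC : commutative xadd.
Proof. by move=> [u|] [v|] //=; rewrite addrC. Qed.

Lemma xadd0 : left_id (XFin 0) xadd.
Proof. by move=> [u|] //=; rewrite add0r. Qed.

HB.instance Definition _ := GRing.isNmodule.Build (xvect E) xaddA xaddC xadd0.

(** Only meaningful for [0 <= r]. *)
Definition xscale (r : R) (x : xvect E) : xvect E :=
  match x with
  | XFin v => XFin (r *: v)
  | XInf => if r == 0 then XFin 0 else XInf
  end.

Definition xsup (A : set (xvect E)) : xvect E := supremum (0 : xvect E) A.

Definition xinf (A : set (xvect E)) : xvect E := infimum (0 : xvect E) A.

End xvect_theory.

(** The sigma-algebra is a bare set of subsets, since a [measurableType] of the
    library is never empty. *)

Section order_integral.
Variables (R : realType) (E : povectType R) (X : Type) (Omega : set (set X)).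

Definition borel_measurable (f : X -> \bar R) :=
  forall B : set (\bar R), measurable B -> Omega (f @^-1` B).

(** Only the values of [mu] on [Omega] matter. *)
Definition is_xmeasure (mu : set X -> xvect E) :=
  [/\ forall A, Omega A -> (0 : xvect E) <= mu A,
      mu set0 = 0 &
      forall D : nat -> set X,
        (forall n, Omega (D n)) -> trivIset setT D ->
        Omega (\bigcup_n D n) ->
        supremums (range (fun N => \sum_(n < N.+1) mu (D n)))
                  (mu (\bigcup_n D n))].

(** An elementary function together with one of its representations. *)
Record elementary := Elementary {
  elem_size : nat ;
  elem_coef : 'I_elem_size -> R ;
  elem_set : 'I_elem_size -> set X ;
  elem_coef_ge0 : forall i, 0 <= elem_coef i ;
  elem_set_measurable : forall i, Omega (elem_set i) ;
  elem_set_disjoint : trivIset setT elem_set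
}.

Definition elem_fun (phi : elementary) (x : X) : R :=
  \sum_(i < elem_size phi) elem_coef i * \1_(@elem_set phi i) x.

Definition elem_integral (mu : set X -> xvect E) (phi : elementary) : xvect E :=
  \sum_(i < elem_size phi) xscale (elem_coef i) (mu (@elem_set phi i)).

Definition increases_to (phi : nat -> elementary) (f : X -> \bar R) :=
  forall x, nondecreasing_seq (fun n => elem_fun (phi n) x) /\
            (elem_fun (phi n) x)%:E @[n --> \oo] --> f x.

Definition is_ointegral (mu : set X -> xvect E) (f : X -> \bar R)
    (v : xvect E) :=
  exists2 phi : nat -> elementary, increases_to phi f &
    supremums (range (fun n => elem_integral mu (phi n))) v.

(** If [E] is sigma-Dedekind complete, [mu] is a measure and [f] is measurable
    and nonnegative, then exactly one value satisfies [is_ointegral mu f];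
    the default value [0] is not used. *)
Definition ointegral (mu : set X -> xvect E) (f : X -> \bar R) : xvect E :=
  xget 0 [set v | is_ointegral mu f v].

End order_integral.

(* Main.v *)
Require Import Defs.
From HB Require Import structures.
From mathcomp Require Import all_boot all_order all_algebra.
From mathcomp Require Import all_classical all_reals all_analysis measurable_realfun.
Import Order.TTheory GRing.Theory Num.Theory.
Import numFieldNormedType.Exports.

Local Open Scope classical_set_scope.
Local Open Scope ring_scope.

(** Fatou's lemma compares the integral of the limit inferior with the integrals
    of the tails [g n x = inf_(k >= n) f k x], which increase to it.  Everything
    rests on one estimate, [elem_integral_le_lim]: if the measurable functions
    [g n] increase to a limit that dominates the elementary function [phi], then
    every [v] that bounds the integrals of all elementary functions below some
    [g n] also bounds the integral of [phi].  For [0 < t < 1] and for the piece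
    [D] of [phi] with coefficient [r], the sets [D `&` {t * r <= g n}] increase
    to [D], and [t * phi] cut down to these sets stays below [g n].  Continuity
    of [mu] from below ([xmeasure_continuous_below]) and compatibility of
    monotone suprema with sums and multiples ([lub_sum], [lub_scale]) show that
    [v] bounds [t] times the integral of [phi].  A sigma-Dedekind complete space
    is Archimedean ([pov_archimedean]), hence [t] may tend to 1.

    The estimate is used twice.  With elementary functions [g n] that increase to
    a measurable [f] and define its integral, it says that elementary functions
    below [f] have an integral below that of [f]
    ([elem_integral_le_ointegral]): this is what is left of monotonicity and of
    independence of the approximating sequence.  With the tails [g n], it gives
    the theorem: an elementary function below [g n] is below every [f k] with
    [n <= k], so its integral is below the infimum of the integrals of these
    [f k], hence below the right-hand side; thus so are the integrals of the
    elementary functions that increase to the limit inferior.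

    Integrals take values in an ordered space that need not be a lattice, so
    upper bounds are tested directly on the least-upper-bound property, and no
    limits are taken in [E]. *)

Set Implicit Arguments.
Unset Strict Implicit.

(** * Suprema in the extended space *)

Section extended_space.
Context {R : realType} {E : povectType R}.
Implicit Types (x y z : xvect E) (u w : nat -> xvect E) (r t : R).

Lemma pov_subr_ge0 (a b : E) : (0 <= b - a) = (a <= b).
Proof.
apply/idP/idP => [/(pov_leD2r _ _ a)|/(pov_leD2r _ _ (- a))].
  by rewrite add0r subrK.
by rewrite subrr.
Qed.

Lemma pov_leNl (a b : E) : (- a <= b) = (- b <= a).
Proof. by rewrite -[LHS]pov_subr_ge0 -[RHS]pov_subr_ge0 !opprK addrC. Qed.

Lemma pov_leNr (a b : E) : (a <= - b) = (b <= - a).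
Proof. by rewrite -[LHS]pov_subr_ge0 -[RHS]pov_subr_ge0 addrC. Qed.

Lemma pov_scale_le r (a b : E) : 0 <= r -> a <= b -> r *: a <= r *: b.
Proof.
rewrite -(pov_subr_ge0 a) -(pov_subr_ge0 (r *: a)) -scalerBr.
exact: pov_scale_ge0.
Qed.

Lemma xle_infty x : x <= XInf. Proof. by case: x. Qed.

Lemma xle_add x y x' y' : x <= y -> x' <= y' -> x + x' <= y + y'.
Proof.
case: x y x' y' => [a|] [b|] [c|] [d|] //= ab cd.
rewrite [_ <= _](_ : _ = (a + c <= b + d)) //.
apply: (le_trans (pov_leD2r _ _ c ab)).
by rewrite ![b + _]addrC pov_leD2r.
Qed.

Lemma xsum_ge0 (I : finType) (F : I -> xvect E) :
  (forall i, (0 : xvect E) <= F i) -> (0 : xvect E) <= \sum_i F i.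
Proof.
move=> F0; apply: (big_ind (fun x => (0 : xvect E) <= x)) => // x y x0 y0.
by rewrite -[0 : xvect E]addr0 xle_add.
Qed.

Lemma xle_sum (I : finType) (F G : I -> xvect E) :
  (forall i, F i <= G i) -> \sum_i F i <= \sum_i G i.
Proof.
by move=> FG; apply: (big_ind2 (fun x y => x <= y)) => // *; exact: xle_add.
Qed.

Lemma xscale0 r : xscale r (0 : xvect E) = 0.
Proof. by rewrite /= scaler0. Qed.

Lemma xscale0r x : xscale 0 x = 0.
Proof. by case: x => [a|] /=; rewrite ?eqxx // scale0r. Qed.

Lemma xscale1 x : xscale 1 x = x.
Proof. by case: x => [a|] /=; rewrite ?scale1r ?oner_eq0. Qed.

Lemma xscaleA r t x : xscale r (xscale t x) = xscale (r * t) x.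
Proof.
case: x => [a|] /=; first by rewrite scalerA.
have [->|t0] := eqVneq t 0; first by rewrite mulr0 eqxx /= scaler0.
by rewrite mulf_eq0 (negbTE t0) orbF.
Qed.

Lemma xscaleD r x y : xscale r (x + y) = xscale r x + xscale r y.
Proof.
have [->|r0] := eqVneq r 0; first by rewrite !xscale0r addr0.
case: x y => [a|] [b|] //=; rewrite ?(negbTE r0) //.
by rewrite [LHS](_ : _ = XFin (r *: (a + b))) // scalerDr.
Qed.

Lemma xscale_sum r (I : finType) (F : I -> xvect E) :
  xscale r (\sum_i F i) = \sum_i xscale r (F i).
Proof.
by apply: (big_morph (xscale r)); [exact: xscaleD|exact: xscale0].
Qed.

Lemma xscale_le r x y : 0 <= r -> x <= y -> xscale r x <= xscale r y.
Proof.
have [->|r0] := eqVneq r 0; first by rewrite !xscale0r.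
case: x y => [a|] [b|] //= r_ge0 ab; rewrite ?(negbTE r0) //.
exact: pov_scale_le.
Qed.

Lemma xscale_ge0 r x :
  0 <= r -> (0 : xvect E) <= x -> (0 : xvect E) <= xscale r x.
Proof. by move=> r0 /(xscale_le r0); rewrite xscale0. Qed.

Lemma xscale_lel r t x :
  (0 : xvect E) <= x -> 0 <= r -> r <= t -> xscale r x <= xscale t x.
Proof.
move=> x0 r0 rt; case: x x0 => [a|] /= a0.
  rewrite [_ <= _](_ : _ = (r *: a <= t *: a)) // -pov_subr_ge0 -scalerBl.
  by apply: pov_scale_ge0; rewrite ?subr_ge0.
have [t0|_] := eqVneq t 0; last exact: xle_infty.
by rewrite (_ : r = 0) ?eqxx //; apply/le_anti; rewrite r0 -t0 rt.
Qed.

Lemma lub_ge u x n : supremums (range u) x -> u n <= x.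
Proof. by case=> ub _; apply: ub; exists n. Qed.

Lemma lub_le u x y : supremums (range u) x -> (forall n, u n <= y) -> x <= y.
Proof. by case=> _ lb uy; apply: lb => _ [n _ <-]. Qed.

Lemma lubP u x : (forall n, u n <= x) ->
  (forall y, (forall n, u n <= y) -> x <= y) -> supremums (range u) x.
Proof.
move=> ux lx; split=> [_ [n _ <-] //|y uy].
by apply: lx => n; apply: uy; exists n.
Qed.

(** Translation by a finite element is an order isomorphism of [E]; an infinite
    [y] forces [z] to be infinite. *)
Lemma lub_le_add u x y z :
  supremums (range u) x -> (forall n, u n + y <= z) -> x + y <= z.
Proof.
case: z => [c|]; last by move=> _ _; exact: xle_infty.
case: y => [b|] ux uyz; last by have := uyz 0%N; case: (u 0%N).
have /(lub_le ux) : forall n, u n <= XFin (c - b).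
  move=> n; have := uyz n; case: (u n) => [a|] // ab.
  by have := pov_leD2r _ _ (- b) ab; rewrite addrK.
case: x ux => [a|] // ux ac.
by have := pov_leD2r _ _ b ac; rewrite subrK.
Qed.

(** By monotonicity, an upper bound of the diagonal [u n + w n] bounds all
    [u n + w m], and the two suprema can then be taken one after the other. *)
Lemma lub_add u w x y :
  nondecreasing_seq u -> nondecreasing_seq w ->
  supremums (range u) x -> supremums (range w) y ->
  supremums (range (fun n => u n + w n)) (x + y).
Proof.
move=> ndu ndw ux wy; apply: lubP => [n|z uwz].
  by apply: xle_add; exact: lub_ge.
rewrite addrC; apply: (lub_le_add wy) => m.
rewrite addrC; apply: (lub_le_add ux) => n.
apply: le_trans (uwz (maxn n m)).
by apply: xle_add; [apply: ndu|apply: ndw]; rewrite ?leq_maxl ?leq_maxr.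
Qed.

Lemma lub_scale r u x : 0 <= r -> supremums (range u) x ->
  supremums (range (fun n => xscale r (u n))) (xscale r x).
Proof.
move=> r0 ux; apply: lubP => [n|z uz].
  by apply: xscale_le => //; exact: lub_ge.
move: r0; rewrite le_eqVlt => /predU1P[r0|r0].
  by move: (uz 0%N); rewrite -r0 !xscale0r.
have rz y : xscale r (xscale r^-1 y) = y.
  by rewrite xscaleA divff ?xscale1 // gt_eqF.
rewrite -[z]rz; apply: xscale_le; first exact: ltW.
apply: (lub_le ux) => n.
have -> : u n = xscale r^-1 (xscale r (u n)).
  by rewrite xscaleA mulVf ?xscale1 // gt_eqF.
by apply: xscale_le; rewrite // invr_ge0 ltW.
Qed.

Lemma lub_sum (I : finType) (F : I -> nat -> xvect E) (x : I -> xvect E) :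
  (forall i, nondecreasing_seq (F i)) ->
  (forall i, supremums (range (F i)) (x i)) ->
  supremums (range (fun n => \sum_i F i n)) (\sum_i x i).
Proof.
move=> ndF Fx.
pose P (u : nat -> xvect E) s := nondecreasing_seq u /\ supremums (range u) s.
suff: P (fun n => \sum_i F i n) (\sum_i x i) by case.
elim: (index_enum I) => [|i s [nds IHs]].
  rewrite big_nil; under eq_fun do rewrite big_nil.
  by split; [move=> *; exact: lexx|apply: lubP => // y /(_ 0%N)].
rewrite big_cons; under eq_fun do rewrite big_cons.
split; last exact: lub_add.
by move=> m n mn; apply: xle_add; [exact: ndF|exact: nds].
Qed.

Hypothesis hE : sigma_dedekind_complete E.

(** The supremum [s] of the multiples of [a] satisfies [s <= s - a], since adding
    [a] only shifts the sequence.  Starting the multiples at 2 makes the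
    factors [1 - 1 / n.+2] below lie strictly between 0 and 1. *)
Lemma pov_archimedean (a b : E) : (forall n : nat, n.+2%:R *: a <= b) -> a <= 0.
Proof.
move=> ab; pose A := range (fun n : nat => n.+2%:R *: a).
have [s [ubs lbs]] : supremums A !=set0.
  apply: hE; [by exists (2%:R *: a), 0%N| |by exists b => _ [n _ <-]].
  exact: sub_countable (card_image_le _ _) (countableP _).
have : s <= s - a.
  apply: lbs => _ [n _ <-].
  have := pov_leD2r _ _ (- a) (ubs (n.+3%:R *: a) (ex_intro2 _ _ n.+1 I erefl)).
  by rewrite -addn1 natrD scalerDl scale1r addrK.
by move=> /(pov_leD2r _ _ (a - s)); rewrite [s + (a - s)]addrC subrK addrA subrK subrr.
Qed.

(** For finite [x = a] and [y = b], the hypothesis at [t = 1 - 1 / n.+2] says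
    that [n.+2 *: (a - b) <= a]; the Archimedean property concludes. *)
Lemma xle_scale_lt1 x y :
  (forall t, 0 < t < 1 -> xscale t x <= y) -> x <= y.
Proof.
case: x y => [a|] [b|] //= xy; last first.
  have := xy 2^-1; rewrite invr_gt0 ltr0n invf_lt1 // ltr1n /=.
  by rewrite invr_eq0 pnatr_eq0 => /(_ isT).
rewrite [_ <= _](_ : _ = (a <= b)) // -pov_subr_ge0 -opprB.
suff /(pov_leD2r _ _ (- (a - b))) : a - b <= 0 by rewrite addrN add0r.
apply: (pov_archimedean (b := a)) => n.
pose t : R := 1 - n.+2%:R^-1.
have t01 : 0 < t < 1.
  by rewrite subr_gt0 invf_lt1 ?ltr0n // ltr1n /= ltrBlDr ltrDl invr_gt0 ltr0n.
have : t *: a <= b by exact: xy t01.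
move=> /(pov_scale_le (ler0n _ n.+2)).
rewrite scalerA /t mulrBr mulr1 divff ?pnatr_eq0 //.
rewrite -pov_subr_ge0 -(pov_subr_ge0 (_ *: (a - b))) scalerBl scale1r scalerBr !opprB.
by rewrite addrCA.
Qed.

(** Either [A] has a finite upper bound, and then all its elements are finite, or
    infinity is its only upper bound. *)
Lemma countable_xsup (A : set (xvect E)) :
  A !=set0 -> countable A -> supremums A !=set0.
Proof.
move=> [a0 Aa0] cA.
have [[b ubb]|nub] := pselect (exists b, ubound A (XFin b)); last first.
  exists XInf; split=> [x _|[b|] ubb]; [exact: xle_infty| |exact: xle_infty].
  by case: nub; exists b.
pose B := [set a | A (XFin a)].
have finA x : A x -> exists2 a, x = XFin a & B a.
  by case: x => [a|] Ax; [exists a|have := ubb _ Ax].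
have [] : supremums B !=set0.
- apply: hE.
  + by have [a _ Ba] := finA _ Aa0; exists a.
  + have /countable_injP[g ginj] := cA; apply/countable_injP.
    exists (fun a => g (XFin a)) => a c; rewrite !inE => Ba Bc /= /ginj.
    by rewrite !inE => /(_ Ba Bc) [].
  + by exists b => a /ubb.
move=> s [ubs lbs]; exists (XFin s); split=> [x /finA[a -> /ubs //]|].
move=> [c|] ubc; last exact: xle_infty.
by apply: lbs => a /ubc.
Qed.

(** The infimum is that of the finite elements, obtained from the supremum of
    their opposites; without finite elements it is infinity. *)
Lemma countable_xinf (A : set (xvect E)) :
  countable A -> lbound A 0 -> infimums A !=set0.
Proof.
move=> cA lbA0.
pose B := [set a | A (XFin (- a))].
have [[a Ba]|B0] := pselect (B !=set0); last first.
  exists XInf; split=> [[a|] // Aa|y _]; last exact: xle_infty.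
  by case: B0; exists (- a); rewrite /B /= opprK.
have [] : supremums B !=set0.
- apply: hE; first by exists a.
  + have /countable_injP[g ginj] := cA; apply/countable_injP.
    exists (fun a => g (XFin (- a))) => b c; rewrite !inE => Bb Bc /ginj.
    by rewrite !inE => /(_ Bb Bc) [] /oppr_inj.
  + exists 0 => c /lbA0 c0.
    by have := pov_leD2r _ _ c c0; rewrite add0r addNr.
move=> s [ubs lbs]; exists (XFin (- s)); split=> [[c|] // Ac|].
  have /ubs cs : B (- c) by rewrite /B /= opprK.
  by rewrite [_ <= _](_ : _ = (- s <= c)) // pov_leNl.
move=> [c|] lbc; last by have := lbc _ Ba.
rewrite [_ <= _](_ : _ = (c <= - s)) // pov_leNr.
by apply: lbs => b /lbc cb; rewrite pov_leNr.
Qed.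

Lemma xsup_ge (A : set (xvect E)) x : countable A -> A x -> x <= xsup A.
Proof.
move=> cA Ax; rewrite /xsup /supremum ifF; last first.
  by apply/eqP => A0; rewrite A0 in Ax.
have [ub _] := xgetPex 0 (countable_xsup (ex_intro _ x Ax) cA).
exact: ub.
Qed.

Lemma xinf_ge (A : set (xvect E)) x :
  A !=set0 -> countable A -> lbound A 0 -> lbound A x -> x <= xinf A.
Proof.
move=> A0 cA lbA lbx; rewrite /xinf /infimum ifF; last first.
  by apply/eqP => A_0; case: A0 => y; rewrite A_0.
by have [_] := xgetPex 0 (countable_xinf cA lbA); apply.
Qed.

End extended_space.

(** * Sigma-algebras and measures *)

Section measure.
Context {R : realType} {E : povectType R} {X : Type} {Omega : set (set X)}.
Hypothesis hOmega : sigma_algebra setT Omega.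
Implicit Types (A B : set X).

Lemma sigma_setC A : Omega A -> Omega (~` A).
Proof. by have [_ OD _] := hOmega; rewrite -setTD; exact: OD. Qed.

Lemma sigma_setU A B : Omega A -> Omega B -> Omega (A `|` B).
Proof.
move=> OA OB; have [S0 _ OU] := hOmega.
by rewrite -bigcup2E; apply: OU => -[|[|n]].
Qed.

Lemma sigma_setI A B : Omega A -> Omega B -> Omega (A `&` B).
Proof.
move=> OA OB; rewrite -[A]setCK -[B]setCK -setCU; apply: sigma_setC.
by apply: sigma_setU; exact: sigma_setC.
Qed.

Lemma sigma_bigcap (F : nat -> set X) :
  (forall n, Omega (F n)) -> Omega (\bigcap_n F n).
Proof.
move=> OF; rewrite -[X in Omega X]setCK setC_bigcap; apply: sigma_setC.
by have [_ _] := hOmega; apply=> n; exact: sigma_setC.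
Qed.

Lemma bigcup_ord_recl n (F : 'I_n.+1 -> set X) :
  \bigcup_i F i = F ord0 `|` \bigcup_i F (lift ord0 i).
Proof.
apply/seteqP; split=> x.
  move=> [i _]; case: (unliftP ord0 i) => [j|] -> Fx; last by left.
  by right; exists j.
by move=> [Fx|[j _ Fx]]; [exists ord0|exists (lift ord0 j)].
Qed.

Lemma sigma_bigcup_ord n (F : 'I_n -> set X) :
  (forall i, Omega (F i)) -> Omega (\bigcup_i F i).
Proof.
elim: n F => [F _|n IHn F OF].
  rewrite (_ : \bigcup_i F i = set0); first by have [] := hOmega.
  by apply/seteqP; split=> // x [[]].
by rewrite bigcup_ord_recl; apply: sigma_setU => //; apply: IHn.
Qed.

Context {mu : set X -> xvect E}.
Hypothesis hmu : is_xmeasure Omega mu.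

Lemma xmeasure_ge0 A : Omega A -> (0 : xvect E) <= mu A.
Proof. by have [+ _ _] := hmu; exact. Qed.

Lemma xmeasure_setU A B : Omega A -> Omega B -> A `&` B = set0 ->
  mu (A `|` B) = mu A + mu B.
Proof.
move=> OA OB AB0; have [S0 _ _] := hOmega; have [_ mu0 muU] := hmu.
have := muU (bigcup2 A B); rewrite -trivIset_bigcup2 bigcup2E.
move=> /(_ _ AB0 (sigma_setU OA OB)).
have OAB n : Omega (bigcup2 A B n) by case: n => [|[|n]].
move=> /(_ OAB) lubAB.
have sumE n : \sum_(k < n.+2) mu (bigcup2 A B k) = mu A + mu B.
  by rewrite !big_ord_recl big1 ?addr0.
apply/le_anti/andP; split; last by rewrite -(sumE 0%N); exact: (lub_ge 1 lubAB).
apply: (lub_le lubAB) => -[|n]; last by rewrite sumE.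
rewrite big_ord_recl big_ord0 addr0 -[leLHS]addr0.
by apply: xle_add => //; exact: xmeasure_ge0.
Qed.

Lemma xmeasure_le A B : Omega A -> Omega B -> A `<=` B -> mu A <= mu B.
Proof.
move=> OA OB AB; have OD : Omega (B `\` A).
  by rewrite setDE; apply: sigma_setI => //; exact: sigma_setC.
rewrite -(setDUK AB) xmeasure_setU ?setDIK // -[leLHS]addr0.
by apply: xle_add => //; exact: xmeasure_ge0.
Qed.

Lemma xmeasure_bigcup_ord n (F : 'I_n -> set X) :
  (forall i, Omega (F i)) -> trivIset setT F ->
  mu (\bigcup_i F i) = \sum_i mu (F i).
Proof.
elim: n F => [F _ _|n IHn F OF tF].
  rewrite big_ord0 (_ : \bigcup_i F i = set0); first by have [] := hmu.
  by apply/seteqP; split=> // x [[]].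
rewrite bigcup_ord_recl big_ord_recl xmeasure_setU //; last first.
- apply/seteqP; split=> // x [F0x [i _ Fix]].
  by have /eqP := tF ord0 (lift ord0 i) I I (ex_intro _ x (conj F0x Fix)).
- exact: sigma_bigcup_ord.
congr (_ + _); apply: IHn => // i j _ _ Fij.
by apply: (@lift_inj _ ord0); exact: tF.
Qed.

(** The differences [seqD F] turn the increasing union into a disjoint one whose
    partial unions are the [F n]. *)
Lemma xmeasure_continuous_below (F : nat -> set X) :
  (forall n, Omega (F n)) -> nondecreasing_seq F ->
  supremums (range (mu \o F)) (mu (\bigcup_n F n)).
Proof.
move=> OF ndF; have [_ _ OU] := hOmega; have [_ _ muU] := hmu.
have OD n : Omega (seqD F n).
  case: n => [|n] //=; rewrite setDE.
  by apply: sigma_setI => //; exact: sigma_setC.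
have tD := trivIset_seqD ndF.
suff -> : mu \o F = fun n => \sum_(k < n.+1) mu (seqD F k).
  by rewrite -(eq_bigcup_seqD F); apply: muU => //; rewrite eq_bigcup_seqD; exact: OU.
apply/funext => n /=; rewrite -[in LHS](nondecreasing_bigsetU_seqD n ndF).
rewrite -(@xmeasure_bigcup_ord _ (fun k : 'I_n.+1 => seqD F k)) //; last first.
  by move=> i j _ _ Fij; apply/val_inj/tD.
congr (mu _); rewrite -bigcup_mkord; apply/seteqP; split=> x.
  by move=> [i /= ltin Fx]; exists (Ordinal ltin).
by move=> [i _ Fx]; exists (i : nat) => //=.
Qed.

End measure.

(** * Integrals of elementary functions *)

Section elementary_integral.
Context {R : realType} {E : povectType R} {X : Type} {Omega : set (set X)}.
Hypothesis hOmega : sigma_algebra setT Omega.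
Implicit Types (phi psi : elementary R Omega) (c t : R).

Lemma elem_fun_in phi i x : elem_set (e:=phi) i x -> elem_fun phi x = elem_coef i.
Proof.
move=> ix; rewrite /elem_fun (bigD1 i) //= indicE mem_set // mulr1 big1 ?addr0 //.
move=> j ji; rewrite indicE memNset ?mulr0 // => jx.
by move/eqP: ji; apply; apply: (@elem_set_disjoint _ _ _ phi) => //; exists x.
Qed.

Lemma elem_fun_out phi x : ~ (\bigcup_i elem_set (e:=phi) i) x -> elem_fun phi x = 0.
Proof.
move=> nx; rewrite /elem_fun big1 // => i _.
by rewrite indicE memNset ?mulr0 // => ix; apply: nx; exists i.
Qed.

Lemma elem_fun_ge0 phi x : 0 <= elem_fun phi x.
Proof.
by apply: sumr_ge0 => i _; apply: mulr_ge0; [exact: elem_coef_ge0|rewrite indicE].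
Qed.

Lemma elem_fun_level phi c : Omega [set x | c <= elem_fun phi x].
Proof.
have [S0 OC _] := hOmega.
have [c0|c0] := leP c 0.
  rewrite (_ : mkset _ = setT); first by rewrite -setC0; exact: sigma_setC.
  apply/seteqP; split=> // x _ /=; apply: le_trans c0 _; exact: elem_fun_ge0.
rewrite (_ : mkset _ = \bigcup_i
    (if c <= elem_coef i then elem_set (e:=phi) i else set0)).
  apply: sigma_bigcup_ord => // i; case: ifP => // _.
  exact: elem_set_measurable.
apply/seteqP; split=> x /=.
  move=> cx; have [[i _ ix]|/elem_fun_out x0] :=
    pselect ((\bigcup_i elem_set (e:=phi) i) x).
    by exists i => //; rewrite -(elem_fun_in ix) cx.
  by move: cx; rewrite x0 leNgt c0.
by move=> [i _]; case: ifP => // ci ix; rewrite (elem_fun_in ix).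
Qed.

Context {mu : set X -> xvect E}.
Hypothesis hmu : is_xmeasure Omega mu.

Lemma elem_integral_ge0 phi : (0 : xvect E) <= elem_integral mu phi.
Proof.
apply: xsum_ge0 => i; apply: xscale_ge0; first exact: elem_coef_ge0.
by apply: (xmeasure_ge0 hmu); exact: elem_set_measurable.
Qed.

(** Both integrals are compared on the common refinement [D i j].  Pieces where
    [phi] vanishes contribute nothing, and the other ones are covered by the
    pieces of [psi]; on a non-empty [D i j] the coefficients are ordered. *)
Lemma elem_integral_le phi psi : (forall x, elem_fun phi x <= elem_fun psi x) ->
  elem_integral mu phi <= elem_integral mu psi.
Proof.
move=> le_phi_psi.
pose D i j := elem_set (e:=phi) i `&` elem_set (e:=psi) j.
have OD i j : Omega (D i j) by apply: sigma_setI => //; exact: elem_set_measurable.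
have tDr i : trivIset setT (D i).
  move=> j k _ _ [x [[_ jx] [_ kx]]].
  by apply: (@elem_set_disjoint _ _ _ psi) => //; exists x.
have tDl j : trivIset setT (D^~ j).
  move=> i k _ _ [x [[ix _] [kx _]]].
  by apply: (@elem_set_disjoint _ _ _ phi) => //; exists x.
apply: (@le_trans _ _ (\sum_i \sum_j xscale (elem_coef (e:=phi) i) (mu (D i j)))).
  apply: xle_sum => i; rewrite -xscale_sum -(xmeasure_bigcup_ord hOmega hmu) //.
  have := elem_coef_ge0 i; rewrite le_eqVlt => /predU1P[<-|r0].
    by rewrite !xscale0r.
  apply: xscale_le; first exact: ltW.
  apply: (xmeasure_le hOmega hmu); first exact: elem_set_measurable.
    exact: sigma_bigcup_ord.
  move=> x ix.
  have [[j _ jx]|/elem_fun_out x0] := pselect ((\bigcup_i elem_set (e:=psi) i) x).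
    by exists j.
  by have := le_phi_psi x; rewrite x0 (elem_fun_in ix) leNgt r0.
rewrite exchange_big /=; apply: xle_sum => j.
apply: (@le_trans _ _ (\sum_i xscale (elem_coef (e:=psi) j) (mu (D i j)))).
  apply: xle_sum => i; have [[x [ix jx]]|Dij0] := pselect (D i j !=set0).
    apply: xscale_lel; [exact: (xmeasure_ge0 hmu)|exact: elem_coef_ge0|].
    by have := le_phi_psi x; rewrite (elem_fun_in ix) (elem_fun_in jx).
  have -> : D i j = set0.
    by apply/seteqP; split=> // x Dx; apply: Dij0; exists x.
  by have [_ -> _] := hmu; rewrite !xscale0.
rewrite -xscale_sum -(@xmeasure_bigcup_ord _ _ _ _ hOmega _ hmu _ (D^~ j)) //.
apply: xscale_le; first exact: elem_coef_ge0.
apply: (xmeasure_le hOmega hmu); first exact: sigma_bigcup_ord.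
  exact: elem_set_measurable.
by move=> x [i _ []].
Qed.

Hypothesis hE : sigma_dedekind_complete E.

(** The monotone convergence argument.  The bound [v] stands in for the integrals
    of the [g n], so that the same statement serves to show that the integral of
    a function does not depend on the approximating sequence. *)
Lemma elem_integral_le_lim phi (g : nat -> X -> \bar R) (v : xvect E) :
  (forall n x, (0%:E <= g n x)%E) ->
  (forall x, nondecreasing_seq (g^~ x)) ->
  (forall n c, Omega [set x | (c%:E <= g n x)%E]) ->
  (forall x c, c < elem_fun phi x -> exists n, (c%:E <= g n x)%E) ->
  (forall n psi, (forall x, ((elem_fun psi x)%:E <= g n x)%E) ->
     elem_integral mu psi <= v) ->
  elem_integral mu phi <= v.
Proof.
move=> g0 ndg Og phig gv.
apply: (xle_scale_lt1 hE) => t /andP[t0 t1].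
pose F i n := elem_set (e:=phi) i `&` [set x | ((t * elem_coef i)%:E <= g n x)%E].
have OF i n : Omega (F i n).
  by apply: sigma_setI => //; exact: elem_set_measurable.
have ndF i : nondecreasing_seq (F i).
  move=> m n mn; apply/subsetPset => x [ix /= mx]; split=> //=.
  exact: le_trans mx (ndg x _ _ mn).
have FE i : \bigcup_n F i n = elem_set i.
  apply/seteqP; split=> x; first by move=> [n _ []].
  move=> ix; have := elem_coef_ge0 i; rewrite le_eqVlt => /predU1P[r0|r0].
    by exists 0%N => //; split=> //=; rewrite -r0 mulr0.
  have [|n gn] := phig x (t * elem_coef i); last by exists n.
  by rewrite (elem_fun_in ix) gtr_pMl.
have tr0 i : 0 <= t * elem_coef (e:=phi) i.
  by apply: mulr_ge0; [exact: ltW|exact: elem_coef_ge0].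
have tF n : trivIset setT (F^~ n).
  move=> i j _ _ [x [[ix _] [jx _]]].
  by apply: (@elem_set_disjoint _ _ _ phi) => //; exists x.
(* [psi n] is [t * phi] restricted to the points where it is below [g n]. *)
pose psi n := Elementary tr0 (OF^~ n) (tF n).
have psi_int_le n : elem_integral mu (psi n) <= v.
  apply: (gv n) => x.
  have [[i _ ix]|/elem_fun_out -> //] :=
    pselect ((\bigcup_i elem_set (e:=psi n) i) x).
  by rewrite (elem_fun_in ix); case: ix.
apply: lub_le psi_int_le.
rewrite /elem_integral xscale_sum /=.
apply: lub_sum => i.
  move=> m n mn; apply: xscale_le => //.
  by apply: (xmeasure_le hOmega hmu) => //; apply/subsetPset/ndF.
rewrite xscaleA; apply: lub_scale => //; rewrite -FE.
exact: (xmeasure_continuous_below hOmega hmu).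
Qed.

End elementary_integral.

(** * The order integral *)

Import HBNNSimple.

Section order_integral.
Context {R : realType} {E : povectType R}.

Lemma increases_toE (X : Type) (Omega : set (set X))
    (phi : nat -> elementary R Omega) (f : X -> \bar R) x :
  increases_to phi f ->
  f x = ereal_sup (range (fun n => (elem_fun (phi n) x)%:E)).
Proof.
move=> /(_ x)[nd cvgf]; apply: cvg_unique cvgf _ => //.
by apply: ereal_nondecreasing_cvgn => m n mn; rewrite lee_fin nd.
Qed.

(** The pieces are the level sets of [h], one for each of its finitely many
    values. *)
Lemma elementary_nnsfun (X : pointedType) (Omega : set (set X))
    (h : {nnsfun (g_sigma_algebraType Omega) >-> R}) :
  sigma_algebra setT Omega ->
  exists phi : elementary R Omega, forall x, elem_fun phi x = h x.
Proof.
move=> hOmega; pose s := finmap.enum_fset (fset_set (range h)).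
have mem_s (i : 'I_(size s)) : range h (nth 0 s i).
  rewrite -(fset_setK (fimfunP h)); exact: mem_nth.
have s0 (i : 'I_(size s)) : 0 <= nth 0 s i by have [x _ <-] := mem_s i.
have Os (i : 'I_(size s)) : Omega (h @^-1` [set nth 0 s i]).
  have := measurable_sfunP h (measurable_set1 (nth 0 s i)).
  by rewrite measurable_g_measurableTypeE.
have ts : trivIset setT (fun i : 'I_(size s) => h @^-1` [set nth 0 s i]).
  move=> i j _ _ [x [/= -> /eqP]]; rewrite nth_uniq ?finmap.fset_uniq //.
  by move=> /eqP /val_inj.
exists (Elementary s0 Os ts) => x; rewrite /elem_fun /= fimfunE fsbig_finite //.
by rewrite (big_nth 0) big_mkord.
Qed.

Lemma pointed_increases_to (X : pointedType) (Omega : set (set X))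
    (f : X -> \bar R) :
  sigma_algebra setT Omega -> (forall x, (0%:E <= f x)%E) ->
  borel_measurable Omega f ->
  exists phi : nat -> elementary R Omega, increases_to phi f.
Proof.
move=> hOmega f0 mf; pose T := g_sigma_algebraType Omega.
have mT : measurable (setT : set T) by exact: measurableT.
have mfT : measurable_fun (setT : set T) f.
  move=> _ B mB; rewrite setTI measurable_g_measurableTypeE //.
  exact: mf.
have /choice[phi phiE] n := elementary_nnsfun (nnsfun_approx mT mfT n) hOmega.
exists phi => x; split; last first.
  under eq_fun do rewrite phiE.
  by apply: (cvg_nnsfun_approx mT mfT).
by move=> m n mn; rewrite !phiE; have /lefP := nd_nnsfun_approx mT mfT mn; exact.
Qed.

Context {X : Type} {Omega : set (set X)}.
Hypothesis hOmega : sigma_algebra setT Omega.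

(** A nonempty [X] becomes a measurable type whose measurable sets are exactly
    [Omega], where dyadic approximation applies; on an empty [X] any sequence
    will do. *)
Lemma exists_increases_to (f : X -> \bar R) :
  (forall x, (0%:E <= f x)%E) -> borel_measurable Omega f ->
  exists phi : nat -> elementary R Omega, increases_to phi f.
Proof.
move=> f0 mf; have [[x0 _]|X0] := pselect (exists x : X, True).
  pose XP : pointedType :=
    HB.pack X (gen_eqMixin X) (gen_choiceMixin X) (isPointed.Build X x0).
  exact: (@pointed_increases_to XP).
have c0 (i : 'I_0) : 0 <= (0 : R) by [].
have S0 (i : 'I_0) : Omega set0 by have [] := hOmega.
have t0 : trivIset setT (fun i : 'I_0 => set0 : set X) by case.
by exists (fun=> Elementary c0 S0 t0) => x; case: X0; exists x.
Qed.

Hypothesis hE : sigma_dedekind_complete E.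
Context {mu : set X -> xvect E}.
Hypothesis hmu : is_xmeasure Omega mu.

Lemma ointegralP (f : X -> \bar R) :
  (forall x, (0%:E <= f x)%E) -> borel_measurable Omega f ->
  is_ointegral Omega mu f (ointegral Omega mu f).
Proof.
move=> f0 mf; have [phi phif] := exists_increases_to f0 mf.
apply: xgetPex.
have [||v supv] := countable_xsup (A := range (fun n => elem_integral mu (phi n))) hE.
- by exists (elem_integral mu (phi 0%N)), 0%N.
- exact: sub_countable (card_image_le _ _) (countableP _).
- by exists v, phi.
Qed.

(** The sequence hidden in [ointegral] is an arbitrary one that increases to [f];
    [elem_integral_le_lim] makes the choice irrelevant. *)
Lemma elem_integral_le_ointegral (f : X -> \bar R) (psi : elementary R Omega) :
  (forall x, (0%:E <= f x)%E) -> borel_measurable Omega f ->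
  (forall x, ((elem_fun psi x)%:E <= f x)%E) ->
  elem_integral mu psi <= ointegral Omega mu f.
Proof.
move=> f0 mf psif; have [phi phif supphi] := ointegralP f0 mf.
apply: (elem_integral_le_lim hOmega hmu hE
          (g := fun n x => (elem_fun (phi n) x)%:E)).
- by move=> n x; rewrite lee_fin elem_fun_ge0.
- by move=> x m n mn; rewrite lee_fin; have [+ _] := phif x; apply.
- by move=> n c; under eq_set do rewrite lee_fin; exact: elem_fun_level.
- move=> x c cpsi; have : (c%:E < f x)%E by rewrite (lt_le_trans _ (psif x)) ?lte_fin.
  rewrite (increases_toE x phif) => /ereal_sup_gt[_ [n _ <-]] /ltW cn.
  by exists n.
- move=> n psi' psi'phi; apply: le_trans (lub_ge n supphi).
  by apply: (elem_integral_le hOmega hmu) => x; rewrite -lee_fin.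
Qed.

Lemma ointegral_ge0 (f : X -> \bar R) :
  (forall x, (0%:E <= f x)%E) -> borel_measurable Omega f ->
  (0 : xvect E) <= ointegral Omega mu f.
Proof.
move=> f0 mf; have [phi _ supphi] := ointegralP f0 mf.
apply: le_trans (lub_ge 0 supphi); exact: (elem_integral_ge0 hmu).
Qed.

End order_integral.

Unset Implicit Arguments.
Set Strict Implicit.

Theorem theorem6p12 (R : realType) (X : Type) (Omega : set (set X))
  (hOmega : sigma_algebra setT Omega)
  (E : povectType R) (hE : sigma_dedekind_complete E)
  (mu : set X -> xvect E) (hmu : is_xmeasure Omega mu)
  (f : nat -> X -> \bar R)
  (hf0 : forall n x, (0%E <= f n x)%E)
  (hfm : forall n, borel_measurable Omega (f n)) :
  ointegral Omega mu (fun x => limn_einf (fun n => f n x)) <=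
  xsup (range (fun n =>
    xinf [set ointegral Omega mu (f k) | k in [set k | (n <= k)%N]])).
Proof.
set S := xsup _.
pose g n x := einfs (f^~ x) n.
have gE n x (y : \bar R) :
    (y <= g n x)%E <-> forall k, (n <= k)%N -> (y <= f k x)%E.
  split=> [yg k nk|yf]; last by apply: le_ereal_inf_tmp => _ [k nk <-]; exact: yf.
  by apply: le_trans yg _; apply: ereal_inf_lbound; exists k.
have cI (A : set nat) (u : nat -> xvect E) : countable [set u n | n in A].
  exact: sub_countable (card_image_le _ _) (countableP _).
have le_S n v : (0 : xvect E) <= v ->
    (forall k, (n <= k)%N -> v <= ointegral Omega mu (f k)) -> v <= S.
  move=> v0 vf; apply: le_trans (xsup_ge hE (cI _ _) (ex_intro2 _ _ n I erefl)).
  apply: (xinf_ge hE); first by exists (ointegral Omega mu (f n)), n => /=.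
  - exact: cI.
  - by move=> _ [k _ <-]; exact: (ointegral_ge0 hOmega hE hmu).
  - by move=> _ [k nk <-]; exact: vf.
have S0 : (0 : xvect E) <= S.
  by apply: (le_S 0%N) => // k _; exact: (ointegral_ge0 hOmega hE hmu).
(* Were the limit inferior to have no integral, the left-hand side would be the
   default value 0, which is below [S]. *)
rewrite /ointegral; case: xgetP => [_ -> [phi phif supphi]|//].
apply: (lub_le supphi) => m.
apply: (elem_integral_le_lim hOmega hmu hE (g := g)).
- by move=> n x; apply/gE => k _; exact: hf0.
- by move=> x; exact: nondecreasing_einfs.
- move=> n c; rewrite (_ : mkset _ =
      \bigcap_k f (n + k)%N @^-1` `[c%:E, +oo[%classic).
    by apply: (sigma_bigcap hOmega) => k; apply/hfm/emeasurable_itv.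
  apply/seteqP; split=> x /=.
    by move=> /gE cg k _; rewrite /= in_itv /= andbT cg ?leq_addr.
  move=> cf; apply/gE => k nk.
  by have := cf (k - n)%N I; rewrite /= in_itv /= andbT subnKC.
- move=> x c cphi.
  have : (c%:E < limn_einf (f^~ x))%E.
    rewrite (increases_toE x phif).
    apply: (@lt_le_trans _ _ (elem_fun (phi m) x)%:E); first by rewrite lte_fin.
    by apply: ereal_sup_ubound; exists m.
  rewrite limn_einf_lim (cvg_lim _ (ereal_nondecreasing_cvgn _)) //; last first.
    exact: nondecreasing_einfs.
  by move=> /ereal_sup_gt[_ [n _ <-]] /ltW; exists n.
- move=> n psi psig; apply: (le_S n); first exact: (elem_integral_ge0 hmu).
  move=> k nk; apply: (elem_integral_le_ointegral hOmega hE hmu) => // x.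
  by have /gE := psig x; apply.
Qed.
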